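(* Let $K$ be a simplicial complex on $m$ vertices and let $J=(j_1,\ldots,j_m)$ be a sequence of positive integers. There is an action of the torus $T^m$ on both $Z(K;(\underline{D}^{2J},\underline{S}^{2J-1}))$ and $Z(K(J);(D^2,S^1))$ (namely, the two actions described in the context) with respect to which the two spaces are equivariantly homeomorphic.
   Context: Simplicial complexes are finite and abstract; $K$ has vertices $v_1,\ldots,v_m$, each of which is a simplex of $K$. A minimal non-face of $K$ is a set of vertices that is not a simplex although every proper subset is one. For $J=(j_1,\ldots,j_m)$ a sequence of positive integers, put $d(J)=j_1+\cdots+j_m$. $K(J)$ is the simplicial complex on the $d(J)$ vertices $v_{11},\ldots,v_{1j_1},v_{21},\ldots,v_{2j_2},\ldots,v_{m1},\ldots,v_{mj_m}$ whose minimal non-faces are exactly the sets $\{v_{i_1 1},\ldots,v_{i_1 j_{i_1}},\ldots,v_{i_k1},\ldots,v_{i_kj_{i_k}}\}$ with $\{v_{i_1},\ldots,v_{i_k}\}$ a minimal non-face of $K$. Polyhedral product: for a complex $K$ on $m$ vertices and a family of CW pairs $(\underline X,\underline A)=\{(X_i,A_i)\}_{i=1}^m$, $Z(K;(\underline X,\underline A))=\bigcup_{\sigma\in K}D(\sigma)\subseteq\prod_{i=1}^mX_i$, where $D(\sigma)=\prod_{i=1}^m W_i$ with $W_i=X_i$ if $v_i\in\sigma$ and $W_i=A_i$ otherwise. When all pairs equal $(X,A)$ one writes $Z(K;(X,A))$. The family $(\underline{D}^{2J},\underline{S}^{2J-1})$ is $\{(D^{2j_i},S^{2j_i-1})\}_{i=1}^m$.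 Actions: view $D^2\subset\mathbb{C}$ and $(D^2)^{j_i}\subset\mathbb{C}^{j_i}$, and write $\underline z_{j_i}=(z_1,\ldots,z_{j_i})$ for a point of $(D^2)^{j_i}$. $T^m$ acts on $(D^2)^{d(J)}=(D^2)^{j_1}\times\cdots\times(D^2)^{j_m}$ by $(t_1,\ldots,t_m)\cdot(\underline z_{j_1},\ldots,\underline z_{j_m})=(t_1\underline z_{j_1},\ldots,t_m\underline z_{j_m})$, where $t_i$ multiplies every coordinate of $\underline z_{j_i}$; this restricts to an action on $Z(K(J);(D^2,S^1))\subseteq(D^2)^{d(J)}$. Choose standard (radial) homeomorphisms of pairs $h_i:((D^2)^{j_i},\partial((D^2)^{j_i}))\to(D^{2j_i},S^{2j_i-1})$; $T^m$ acts on $D^{2j_1}\times\cdots\times D^{2j_m}$ by $(t_1,\ldots,t_m)\cdot(h_1(\underline z_{j_1}),\ldots,h_m(\underline z_{j_m}))=(h_1(t_1\underline z_{j_1}),\ldots,h_m(t_m\underline z_{j_m}))$, and this restricts to an action on $Z(K;(\underline{D}^{2J},\underline{S}^{2J-1}))$. *)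

(* Defs.v *)
From HB Require Import structures.
From mathcomp Require Import all_boot all_order all_algebra.
From mathcomp Require Import ring.

Set Implicit Arguments.
Unset Strict Implicit.
Unset Printing Implicit Defensive.

Record simplicial_complex (V : finType) := SimplicialComplex {
  simplices :> {set {set V}};
  simplices0 : set0 \in simplices;
  simplices1 : forall v, [set v] \in simplices;
  simplicesS : forall s t : {set V},
    t \subset s -> s \in simplices -> t \in simplices }.

Definition minimal_nonface (V : finType) (K : simplicial_complex V) :
    pred {set V} :=
  [pred s | (s \notin K) && [forall t : {set V}, (t \proper s) ==> (t \in K)]].

Lemma nonface_minimal (V : finType) (K : simplicial_complex V) (s : {set V}) :
  s \notin K -> exists2 t, minimal_nonface K t & t \subset s.
Proof.
move=> sK; have [t /minsetP[tK tmin] ts] := minset_exists (sK : [pred u | u \notin K] s).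
exists t => //; rewrite /minimal_nonface /= (tK : t \notin K) /=.
apply/forallP => u; apply/implyP => ut; apply: contraT => uK.
by move: (ut); rewrite (tmin u uK (proper_sub ut)) properxx.
Qed.

Lemma minimal_nonface_inj (V : finType) (K L : simplicial_complex V) :
  minimal_nonface K =1 minimal_nonface L -> simplices K = simplices L.
Proof.
move=> KL; apply/setP => s; apply/idP/idP; apply: contraLR.
- move=> /nonface_minimal[t]; rewrite -KL => /andP[tK _] ts.
  by apply: contra tK; apply: simplicesS.
- move=> /nonface_minimal[t]; rewrite KL => /andP[tK _] ts.
  by apply: contra tK; apply: simplicesS.
Qed.

Section SimplicialWedge.
Variables (m : nat) (J : 'I_m -> nat).

(* [Tagged (fun i => 'I_(J i)) k] is the vertex v_{i,k+1}. *)
Definition wedge_vertex : finType := {i : 'I_m & 'I_(J i)}.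

Definition blocks (s : {set 'I_m}) : {set wedge_vertex} :=
  [set v | tag v \in s].

Hypothesis J_gt0 : forall i, 0 < J i.

Lemma blocksS s t : (blocks s \subset blocks t) = (s \subset t).
Proof.
apply/subsetP/subsetP => st => [i si|v]; last by rewrite !inE; apply: st.
have := st (Tagged (fun i => 'I_(J i)) (Ordinal (J_gt0 i))).
by rewrite !inE; apply.
Qed.

Lemma simplicial_wedge_exists (K : simplicial_complex 'I_m) :
  {L : simplicial_complex wedge_vertex | forall s,
     minimal_nonface L s <-> exists2 t, minimal_nonface K t & s = blocks t}.
Proof.
pose F := [set s : {set wedge_vertex} |
  [forall t, minimal_nonface K t ==> ~~ (blocks t \subset s)]].
have FP (s : {set wedge_vertex}) : reflect (exists2 t, minimal_nonface K t & blocks t \subset s)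
    (s \notin F).
  rewrite inE negb_forall; apply: (iffP existsP) => -[t].
    by rewrite negb_imply negbK => /andP[tK ts]; exists t.
  by move=> tK ts; exists t; rewrite negb_imply negbK tK.
have F0 : set0 \in F.
  apply: contraT => /FP[t /andP[tK _]] t0; case/negP: tK.
  suff -> : t = set0 by apply: simplices0.
  by apply/eqP; rewrite -subset0 -blocksS (subset_trans t0) ?sub0set.
have F1 v : [set v] \in F.
  apply: contraT => /FP[t /andP[tK _]] tv; case/negP: tK.
  apply: simplicesS (simplices1 K (tag v)); rewrite -blocksS.
  by apply: subset_trans tv _; rewrite sub1set !inE.
have FS (s t : {set wedge_vertex}) : t \subset s -> s \in F -> t \in F.
  move=> ts; apply: contraLR => /FP[u uK ut]; apply/FP; exists u => //.
  exact: subset_trans ut ts.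
exists (SimplicialComplex F0 F1 FS) => s; split.
  case/andP => /FP[t tK ts] /forallP smin; exists t => //; apply/eqP.
  rewrite eqEsubset ts andbT; apply: contraT => nst.
  have /implyP := smin (blocks t); rewrite properE ts nst => /(_ isT).
  by move=> tF; have /negP[] : blocks t \notin F by apply/FP; exists t.
case=> t tK ->; apply/andP; split; first by apply/FP; exists t.
apply/forallP => u; apply/implyP => ut; apply: contraT => /FP[t' t'K t'u].
have := sub_proper_trans t'u ut; rewrite properE !blocksS -properE => t't.
case/andP: tK => _ /forallP/(_ t')/implyP/(_ t't) t'F.
by case/andP: t'K; rewrite t'F.
Qed.

(* K(J); by [minimal_nonface_inj] it is determined by its minimal non-faces. *)
Definition simplicial_wedge (K : simplicial_complex 'I_m) :
  simplicial_complex wedge_vertex := sval (simplicial_wedge_exists K).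

Lemma minimal_nonface_wedge (K : simplicial_complex 'I_m) s :
  minimal_nonface (simplicial_wedge K) s <->
  exists2 t, minimal_nonface K t & s = blocks t.
Proof. exact: (svalP (simplicial_wedge_exists K)). Qed.

End SimplicialWedge.

(* Loaded only here: it would shadow the finite-set notations used above. *)
From mathcomp Require Import all_classical all_reals all_analysis.
From mathcomp Require Import complex.

Import Order.TTheory GRing.Theory Num.Theory.
Import numFieldNormedType.Exports.

Local Open Scope classical_set_scope.
Local Open Scope ring_scope.

Section PolyhedralProduct.
Variables (V : finType) (E : V -> topologicalType).

(* D(sigma) *)
Definition face_product (X A : forall v, set (E v)) (s : {set V}) :
    set (prod_topology E) :=
  [set x | forall v, (if v \in s then X v else A v) (x v)].

Definition polyhedral_product (K : simplicial_complex V)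
    (X A : forall v, set (E v)) : set (prod_topology E) :=
  \bigcup_(s in [set s | s \in simplices K]) face_product X A s.

End PolyhedralProduct.

Record homeomorphism (X Y : topologicalType) (A : set X) (B : set Y) :=
  Homeomorphism {
    homeo :> X -> Y;
    homeoV : Y -> X;
    homeo_fun : set_fun A B homeo;
    homeoV_fun : set_fun B A homeoV;
    homeoK : {in A, cancel homeo homeoV};
    homeoVK : {in B, cancel homeoV homeo};
    homeo_continuous : {within A, continuous homeo};
    homeoV_continuous : {within B, continuous homeoV} }.

Definition boundary (X : topologicalType) (A : set X) : set X :=
  closure A `\` A°.

Section Complex.
Variable R : realType.

(* The declared type [numClosedFieldType] is what gives C its topology: the
   library puts one on every such field, but not on [R[i]] itself. *)
Definition Cplx : numClosedFieldType := R[i].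

Definition disc : set Cplx := [set z | `|z| <= 1].
Definition circle : set Cplx := [set z | `|z| = 1].

Section CoordinateSpace.
Variable j : nat.

Definition polydisc : set 'rV[Cplx]_j := [set z | forall k, disc (z ord0 k)].

Definition norm2 (z : 'rV[Cplx]_j) : Cplx := sqrtC (\sum_k `|z ord0 k| ^+ 2).

(* D^{2j} and S^{2j-1}, with R^{2j} identified with C^j. *)
Definition ball2 : set 'rV[Cplx]_j := [set z | norm2 z <= 1].
Definition sphere2 : set 'rV[Cplx]_j := [set z | norm2 z = 1].

(* The homeomorphisms of pairs from ((D^2)^j, boundary) to (D^{2j}, S^{2j-1})
   that preserve each ray from the origin; [standard_radial_homeomorphism]
   below shows that they exist. *)
Record radial_homeomorphism := RadialHomeomorphism {
  radial_homeo :> homeomorphism polydisc ball2;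
  radial_homeo_boundary : radial_homeo @` boundary polydisc = sphere2;
  radial_homeo_ray : forall z, polydisc z ->
    exists2 c : Cplx, 0 < c & radial_homeo z = c *: z }.

Implicit Types z w : 'rV[Cplx]_j.

Lemma norm2_ge0 z : 0 <= norm2 z.
Proof. by rewrite sqrtC_ge0 sumr_ge0 // => k _; rewrite exprn_ge0. Qed.

Lemma norm2Z (c : Cplx) z : norm2 (c *: z) = `|c| * norm2 z.
Proof.
rewrite /norm2; under eq_bigr do rewrite mxE normrM exprMn.
rewrite -mulr_sumr sqrtCM ?sqrCK ?nnegrE ?exprn_ge0 ?sumr_ge0 //.
Qed.

Lemma norm_coord z k : `|z ord0 k| <= `|z|.
Proof.
rewrite [leRHS]/Num.norm/= mx_normE -[leLHS]nngE num_le.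
exact: (le_bigmax _ (fun i => `|z i.1 i.2|%:nng) (ord0, k)).
Qed.

Lemma norm_le_norm2 z : `|z| <= norm2 z.
Proof.
have [->|z0] := eqVneq z 0; first by rewrite normr0 norm2_ge0.
have zn0 : mx_norm z != 0 by apply: contraNneq z0 => /mx_norm_eq0 ->.
have [[i k] /= zk] := mx_norm_neq0 zn0; rewrite [leLHS]zk ord1.
rewrite -[leLHS]sqrCK // /norm2 ler_sqrtC ?nnegrE ?exprn_ge0 ?sumr_ge0 //.
  by rewrite (bigD1 k) //= lerDl sumr_ge0 // => l _; rewrite exprn_ge0.
Qed.

Lemma polydiscE : polydisc = [set z | `|z| <= 1].
Proof.
apply/seteqP; split=> z /= zP; last by move=> k; apply: le_trans (norm_coord _ _) zP.
have [->|z0] := eqVneq z 0; first by rewrite normr0.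
have zn0 : mx_norm z != 0 by apply: contraNneq z0 => /mx_norm_eq0 ->.
by have [[i k] /= zk] := mx_norm_neq0 zn0; rewrite [leLHS]zk ord1; exact: zP.
Qed.

Lemma boundary_polydiscE : boundary polydisc = [set z | `|z| = 1].
Proof.
rewrite polydiscE; apply/seteqP; split => z /=.
- case=> cz iz.
  have z1 : `|z| <= 1.
    apply/ler_addgt0Pl => e e0.
    have /cz[w /= [w1 zw]] : nbhs z (ball z e) by exact: nbhsx_ballx.
    move: zw; rewrite -ball_normE /= => zw.
    have -> : z = (z - w) + w by rewrite subrK.
    by apply: le_trans (ler_normD _ _) _; apply: lerD w1; apply: ltW.
  apply: contra_notP iz => /eqP zn1.
  have e0 : 0 < 1 - `|z| by rewrite subr_gt0 lt_neqAle zn1.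
  apply: filterS (nbhsx_ballx z _ e0) => w; rewrite -ball_normE /= => zw.
  have -> : w = z - (z - w) by rewrite opprB addrC subrK.
  apply: le_trans (ler_normB _ _) _.
  by rewrite -lerBrDl ltW.
- move=> z1; split; first by apply: subset_closure => /=; rewrite z1.
  move=> /nbhs_ballP[e /= e0 /(_ ((1 + e / 2) *: z))].
  have e20 : 0 < e / 2 by rewrite divr_gt0.
  rewrite -ball_normE /= scalerDl scale1r opprD addNKr normrN normrZ z1 mulr1.
  rewrite gtr0_norm // ltr_pdivrMr // ltr_pMr // ltr1n => /(_ isT).
  rewrite -[X in X + _]scale1r -scalerDl normrZ z1 mulr1 gtr0_norm ?addr_gt0 //.
  by rewrite gerDl => /le_lt_trans/(_ e20); rewrite ltxx.
Qed.

Lemma norm2_continuous : continuous norm2.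
Proof.
move=> z; apply/(@cvgrPdist_lt _ Cplx _ (nbhs z)) => e e0.
have sq w : 0 <= \sum_k `|w ord0 k| ^+ 2 :> Cplx.
  by rewrite sumr_ge0 // => k _; rewrite exprn_ge0.
have : {for z, continuous (fun w => \sum_k `|w ord0 k| ^+ 2 : Cplx)}.
  apply: (continuous_big add_continuous) => k _ w.
  rewrite /= (_ : (fun v : 'rV[Cplx]_j => `|v ord0 k| ^+ 2) =
    (fun v => `|v ord0 k| * `|v ord0 k|)); last by apply/funext.
  have ck : (fun v : 'rV[Cplx]_j => v ord0 k) x @[x --> w] --> (w ord0 k : Cplx).
    exact: coord_continuous.
  have nk := @cvg_norm Cplx Cplx _ (nbhs w) (nbhs_filter w) _ _ ck.
  exact: (@cvgM Cplx _ (nbhs w) (nbhs_filter w) _ _ _ _ nk nk).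
move=> /(@cvgrPdist_lt _ Cplx _ (nbhs z))/(_ _ (exprn_gt0 2 e0)); apply: filterS => w /= zw.
rewrite -(@ltr_pXn2r _ 2) ?nnegrE // ?ltW //; apply: le_lt_trans zw.
rewrite -[X in _ <= `|X - _|]sqrtCK -[X in _ <= `|_ - X|]sqrtCK.
rewrite subr_sqr normrM expr2 ler_wpM2l //.
rewrite [leRHS]ger0_norm ?addr_ge0 ?norm2_ge0 //.
apply: le_trans (ler_normB _ _) _.
by rewrite !ger0_norm ?norm2_ge0.
Qed.

(* Linear on each ray, taking the max-norm to the Euclidean norm; at the origin
   0 / 0 = 0 causes no harm. *)
Definition to_ball z : 'rV[Cplx]_j := (`|z| / norm2 z) *: z.
Definition of_ball w : 'rV[Cplx]_j := (norm2 w / `|w|) *: w.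

Lemma norm2_gt0 z : z != 0 -> 0 < norm2 z.
Proof. by rewrite -normr_gt0 => /lt_le_trans; apply; exact: norm_le_norm2. Qed.

Lemma norm2_0 : norm2 0 = 0.
Proof. by rewrite -(scale0r (0 : 'rV[Cplx]_j)) norm2Z normr0 mul0r. Qed.

Lemma norm2_to_ball z : norm2 (to_ball z) = `|z|.
Proof.
have [->|z0] := eqVneq z 0; first by rewrite /to_ball scaler0 norm2_0 normr0.
rewrite norm2Z ger0_norm ?divr_ge0 ?norm2_ge0 // divfK //.
by rewrite gt_eqF // norm2_gt0.
Qed.

Lemma norm_of_ball w : `|of_ball w| = norm2 w.
Proof.
have [->|w0] := eqVneq w 0; first by rewrite /of_ball scaler0 norm2_0 normr0.
by rewrite normrZ ger0_norm ?divr_ge0 ?norm2_ge0 // divfK // normr_eq0.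
Qed.

Lemma to_ballK : cancel to_ball of_ball.
Proof.
move=> z; have [->|z0] := eqVneq z 0; first by rewrite /of_ball /to_ball !scaler0.
have n0 : norm2 z != 0 by rewrite gt_eqF // norm2_gt0.
have z0' : `|z| != 0 by rewrite normr_eq0.
rewrite /of_ball norm2_to_ball /to_ball normrZ scalerA.
rewrite ger0_norm ?divr_ge0 ?norm2_ge0 //.
suff -> : `|z| / (`|z| / norm2 z * `|z|) * (`|z| / norm2 z) = 1 by rewrite scale1r.
by field; rewrite n0 z0'.
Qed.

Lemma of_ballK : cancel of_ball to_ball.
Proof.
move=> z; have [->|z0] := eqVneq z 0; first by rewrite /of_ball /to_ball !scaler0.
have n0 : norm2 z != 0 by rewrite gt_eqF // norm2_gt0.
have z0' : `|z| != 0 by rewrite normr_eq0.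
rewrite /to_ball norm_of_ball /of_ball norm2Z scalerA.
rewrite ger0_norm ?divr_ge0 ?norm2_ge0 //.
suff -> : norm2 z / (norm2 z / `|z| * norm2 z) * (norm2 z / `|z|) = 1
  by rewrite scale1r.
by field; rewrite n0 z0'.
Qed.

Lemma to_ball_continuous : continuous to_ball.
Proof.
move=> z; have [->|z0] := eqVneq z 0.
  apply/(@cvgrPdist_lt Cplx 'rV[Cplx]_j _ (nbhs (0 : 'rV[Cplx]_j))) => e e0.
  apply: filterS (nbhsx_ballx (0 : 'rV[Cplx]_j) e e0) => w.
  rewrite -ball_normE /= {1}/to_ball scaler0 !sub0r !normrN => we.
  by apply: le_lt_trans (norm_le_norm2 _) _; rewrite norm2_to_ball.
have n0 : norm2 z != 0 by rewrite gt_eqF // norm2_gt0.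
have nz := @norm_continuous Cplx 'rV[Cplx]_j z.
have nV := @cvgV Cplx _ (nbhs z) (nbhs_filter z) _ _ n0 (@norm2_continuous z).
have nM := @cvgM Cplx _ (nbhs z) (nbhs_filter z) _ _ _ _ nz nV.
exact: (@cvgZ Cplx _ _ (nbhs z) (nbhs_filter z) _ _ _ _ nM cvg_id).
Qed.

Lemma of_ball_continuous : continuous of_ball.
Proof.
move=> z; have [->|z0] := eqVneq z 0.
  apply/(@cvgrPdist_lt Cplx 'rV[Cplx]_j _ (nbhs (0 : 'rV[Cplx]_j))) => e e0.
  have /(@cvgrPdist_lt Cplx Cplx _ (nbhs (0 : 'rV[Cplx]_j)))/(_ e e0) :=
    @norm2_continuous 0.
  apply: filterS => w; rewrite norm2_0 {1}/of_ball scaler0 !sub0r !normrN.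
  by rewrite norm_of_ball ger0_norm ?norm2_ge0.
have n0 : `|z| != 0 by rewrite normr_eq0.
have nz := @norm_continuous Cplx 'rV[Cplx]_j z.
have nV := @cvgV Cplx _ (nbhs z) (nbhs_filter z) _ _ n0 nz.
have nM := @cvgM Cplx _ (nbhs z) (nbhs_filter z) _ _ _ _ (@norm2_continuous z) nV.
exact: (@cvgZ Cplx _ _ (nbhs z) (nbhs_filter z) _ _ _ _ nM cvg_id).
Qed.

Lemma to_ball_fun : set_fun polydisc ball2 to_ball.
Proof. by move=> z; rewrite polydiscE /ball2 /= norm2_to_ball. Qed.

Lemma of_ball_fun : set_fun ball2 polydisc of_ball.
Proof. by move=> w; rewrite polydiscE /ball2 /= norm_of_ball. Qed.

Definition ball_homeomorphism : homeomorphism polydisc ball2 :=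
  @Homeomorphism _ _ polydisc ball2 to_ball of_ball to_ball_fun of_ball_fun
    (in1W to_ballK) (in1W of_ballK)
    (continuous_subspaceT to_ball_continuous)
    (continuous_subspaceT of_ball_continuous).

Lemma ball_homeomorphism_boundary :
  ball_homeomorphism @` boundary polydisc = sphere2.
Proof.
rewrite boundary_polydiscE; apply/seteqP; split=> [_ [z z1 <-]|w w1] /=.
  by rewrite /sphere2 /= norm2_to_ball.
by exists (of_ball w); rewrite /= ?norm_of_ball ?of_ballK.
Qed.

Lemma ball_homeomorphism_ray z : polydisc z ->
  exists2 c : Cplx, 0 < c & ball_homeomorphism z = c *: z.
Proof.
move=> _; have [->|z0] := eqVneq z 0.
  by exists 1 => //=; rewrite /to_ball !scaler0.
by exists (`|z| / norm2 z); rewrite // divr_gt0 ?normr_gt0 ?norm2_gt0.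
Qed.

Definition standard_radial_homeomorphism : radial_homeomorphism :=
  RadialHomeomorphism ball_homeomorphism_boundary ball_homeomorphism_ray.

End CoordinateSpace.

Definition Z_ball (m : nat) (K : simplicial_complex 'I_m) (J : 'I_m -> nat) :
    set (prod_topology (fun i : 'I_m => 'rV[Cplx]_(J i))) :=
  polyhedral_product (E := fun i => 'rV[Cplx]_(J i)) K
    (fun i => @ball2 (J i)) (fun i => @sphere2 (J i)).

Definition Z_disc (V : finType) (L : simplicial_complex V) :
    set (prod_topology (fun _ : V => Cplx)) :=
  polyhedral_product (E := fun _ => Cplx) L (fun=> disc) (fun=> circle).

Definition torus (m : nat) : set (prod_topology (fun _ : 'I_m => Cplx)) :=
  [set t | forall i, circle (t i)].

(* The values of [act] off [torus m] and [A] are irrelevant. *)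
Definition torus_action (m : nat) (X : topologicalType) (A : set X)
    (act : prod_topology (fun _ : 'I_m => Cplx) -> X -> X) : Prop :=
  [/\ forall t x, torus t -> A x -> A (act t x),
      forall x, A x -> act (fun=> 1) x = x,
      forall t u x, torus t -> torus u -> A x ->
        act (fun i => t i * u i) x = act t (act u x) &
      {within @torus m `*` A, continuous (fun p => act p.1 p.2)} ].

Definition equivariantly_homeomorphic (m : nat) (X Y : topologicalType)
    (A : set X) (B : set Y)
    (actA : prod_topology (fun _ : 'I_m => Cplx) -> X -> X)
    (actB : prod_topology (fun _ : 'I_m => Cplx) -> Y -> Y) : Prop :=
  exists f : homeomorphism A B,
    forall t x, torus t -> A x -> f (actA t x) = actB t (f x).

Section Actions.
Variables (m : nat) (J : 'I_m -> nat).

(* t . (h_i z_i)_i = (h_i (t_i z_i))_i *)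
Definition ball_action (h : forall i, radial_homeomorphism (J i))
    (t : prod_topology (fun _ : 'I_m => Cplx))
    (w : prod_topology (fun i : 'I_m => 'rV[Cplx]_(J i))) :
    prod_topology (fun i : 'I_m => 'rV[Cplx]_(J i)) :=
  fun i => h i (t i *: homeoV (h i) (w i)).

(* (D^2)^{d(J)} = (D^2)^{j_1} x ... x (D^2)^{j_m} is seen as a space of functions
   on the d(J) vertices of K(J). *)
Definition diagonal_action (t : prod_topology (fun _ : 'I_m => Cplx))
    (z : prod_topology (fun _ : wedge_vertex J => Cplx)) :
    prod_topology (fun _ : wedge_vertex J => Cplx) :=
  fun v => t (tag v) * z v.

End Actions.
End Complex.

Arguments Z_ball R {m} K J.
Arguments Z_disc R {V} L.
Arguments diagonal_action {R m J} t z.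
Arguments ball_action {R m J} h t w.

(* Main.v *)
(* Reading the blocks of a point of (D^2)^{d(J)} as row vectors and applying the
   homeomorphisms h_i gives a homeomorphism onto D^{2j_1} x ... x D^{2j_m} under
   which, by definition, the two torus actions correspond. It matches the
   polyhedral products: s is a face of K(J) iff the indices i of the blocks
   contained in s form a face of K, and the i-th block of z lies entirely in the
   set of coordinates off the circle iff it is off the boundary of the polydisc,
   i.e. iff its image under h_i is off the sphere. *)
Require Import Defs.
From mathcomp Require Import all_boot all_order all_algebra.
From mathcomp Require Import all_classical all_reals all_analysis.
From mathcomp Require Import complex.

Import numFieldNormedType.Exports.

Set Implicit Arguments.
Unset Strict Implicit.
Unset Printing Implicit Defensive.

Section Proof.
Import Order.TTheory GRing.Theory Num.Theory.
Local Open Scope classical_set_scope.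
Local Open Scope ring_scope.

(** * Continuity on subspaces and into products and matrix spaces *)

Lemma within_continuous_comp_fun (X Y Z : topologicalType) (A : set X) (B : set Y)
    (f : X -> Y) (g : Y -> Z) :
  set_fun A B f -> {within A, continuous f} -> {within B, continuous g} ->
  {within A, continuous (g \o f)}.
Proof.
move=> fAB /subspace_continuousP cf /subspace_continuousP cg.
apply/subspace_continuousP => x Ax; apply: cvg_trans (cg _ (fAB _ Ax)).
move=> P /(cf _ Ax); rewrite /= /nbhs /= /within /= => fP.
by apply: filterS fP => y PA Ay; apply: PA => //; apply: fAB.
Qed.

(** The product topology is the supremum of the topologies induced by the projections. Since [X] may
    be a subspace, this also covers goals of the form [{within A, continuous f}]. *)
Lemma continuous_prod_topology (I : Type) (E : I -> topologicalType)
    (X : topologicalType) (f : X -> prod_topology E) :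
  (forall i, continuous (fun x => f x i)) -> continuous f.
Proof.
move=> cf x; apply/cvg_sup => i U [_ [[C oC <-] Cx CU]].
apply: filterS CU _; exact: (cf i x C (open_nbhs_nbhs (conj oC Cx))).
Qed.

Lemma continuous_mx (X T : topologicalType) (m n : nat) (f : X -> 'M[T]_(m, n)) :
  (forall i j, continuous (fun x => f x i j)) -> continuous f.
Proof.
move=> cf x U [P Px PU]; rewrite /= /nbhs /=.
have := filter_forall (nbhs_filter x)
  (fun ij : 'I_m * 'I_n => cf ij.1 ij.2 x _ (Px ij.1 ij.2)).
by apply: filterS => y yP; apply: PU => i j; apply: (yP (i, j)).
Qed.

(** * Membership in polyhedral products and faces of K(J) *)

(** The coordinates of [x] outside [A] form the smallest [s] that can witness membership; as faces
    are closed under subsets, testing this one set suffices. *)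
Lemma polyhedral_productP (V : finType) (E : V -> topologicalType)
    (K : simplicial_complex V) (X A : forall v, set (E v)) (x : prod_topology E) :
  (forall v, A v `<=` X v) ->
  polyhedral_product K X A x <->
  (forall v, X v (x v)) /\ [set v | ~~ `[< A v (x v) >]]%SET \in simplices K.
Proof.
move=> AX; split=> [[s /= sK xs]|[xX xK]].
  split=> [v|]; first by have := xs v; case: ifP => // _; apply: AX.
  apply: simplicesS sK; apply/fintype.subsetP => v; rewrite inE; apply: contraNT => vs.
  by apply/asboolP; have := xs v; rewrite (negbTE vs).
exists [set v | ~~ `[< A v (x v) >]]%SET => // v.
by rewrite inE; case: asboolP => // _; apply: xX.
Qed.

(** A union of blocks lies in [s] iff its indices lie in the set [c] of indices of full blocks, so
    minimal non-faces of K(J) inside [s] correspond to minimal non-faces of [K] inside [c]. *)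
Lemma mem_simplicial_wedge (m : nat) (J : 'I_m -> nat)
    (J_gt0 : forall i, (0 < J i)%N) (K : simplicial_complex 'I_m)
    (s : {set wedge_vertex J}) :
  (s \in simplices (simplicial_wedge J_gt0 K)) =
  ([set i | [forall k : 'I_(J i), Tagged (fun i => 'I_(J i)) k \in s]]%SET
     \in simplices K).
Proof.
set c := [set i | _]%SET.
have blockss t : (blocks J t \subset s) = (t \subset c).
  apply/fintype.subsetP/fintype.subsetP => st => [i it|[i k]].
    by rewrite inE; apply/forallP => k; apply: st; rewrite inE.
  by rewrite inE /= => /st; rewrite inE => /forallP/(_ k).
apply/idP/idP; apply: contraLR => /nonface_minimal[t].
  move=> tK; rewrite -blockss => ts; apply/negP => sL.
  have /andP[/negP[]] :
      minimal_nonface (simplicial_wedge J_gt0 K) (blocks J t).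
    by apply/minimal_nonface_wedge; exists t.
  exact: simplicesS ts sL.
move=> /minimal_nonface_wedge[u uK ->]; rewrite blockss => uc.
by case/andP: uK => uK _; apply: contra uK; apply: simplicesS.
Qed.

(** * Pulling a torus action back along a homeomorphism *)

Section Transport.
Variables (R : realType) (m : nat) (X Y : topologicalType).
Variables (A : set X) (B : set Y) (f : homeomorphism A B).
Variable act : prod_topology (fun _ : 'I_m => Cplx R) -> Y -> Y.
Hypothesis act_torus : torus_action B act.

(** Lets the action laws and continuity be checked for the diagonal action only, the ball action
    being its conjugate. *)
Lemma torus_action_conj : torus_action A (fun t x => homeoV f (act t (f x))).
Proof.
case: act_torus => actB act1 actM act_cont.
have fAB := homeo_fun f; have gBA := homeoV_fun f.
split=> [t x tT xA|x xA|t u x tT uT xA|].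
- exact/gBA/actB/fAB.
- by rewrite act1 ?homeoK ?inE //; apply: fAB.
- have fxB := fAB _ xA; have axB := actB _ _ uT fxB.
  by rewrite homeoVK ?inE // actM.
- have fX_cont : {within @torus R m `*` A, continuous (fun p => (p.1, f p.2))}.
    apply/subspace_continuousP => -[t x] [/= tT xA].
    have fst_cvg : fst @ within (@torus R m `*` A) (nbhs (t, x)) --> t.
      move=> P tP; apply: (cvg_within (F := nbhs (t, x))).
      exact: (cvg_fst (F := nbhs t) (FG := nbhs_filter x) tP).
    (* [f] is continuous only on [A]; the restriction to [torus] times [A] supplies the membership
       of the second component in [A]. *)
    have snd_cvg : f p.2 @[p --> within (@torus R m `*` A) (nbhs (t, x))] --> f x.
      have /subspace_continuousP/(_ _ xA) := @homeo_continuous _ _ _ _ f.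
      move=> fA P /fA; rewrite /= /nbhs /= /within /= => fP.
      have := cvg_snd (G := nbhs x) (FF := nbhs_filter t) fP.
      apply: (filterS (F := nbhs (t, x))) => -[u y] /= fy [_ yA]; exact: fy.
    exact: (cvg_pair fst_cvg snd_cvg).
  have fX_fun : set_fun (@torus R m `*` A) (@torus R m `*` B)
    (fun p => (p.1, f p.2)).
    by move=> [u y] [/= uT yA]; split=> //; apply: fAB.
  have act_fun : set_fun (@torus R m `*` B) B (fun p => act p.1 p.2).
    by move=> [t y] [/= tT yB]; apply: actB.
  have := within_continuous_comp_fun fX_fun fX_cont act_cont.
  move=> /(within_continuous_comp_fun _)/(_ (@homeoV_continuous _ _ _ _ f)); apply.
  by move=> p /fX_fun/act_fun.
Qed.

Lemma equivariantly_homeomorphic_conj :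
  equivariantly_homeomorphic A B (fun t x => homeoV f (act t (f x))) act.
Proof.
case: act_torus => actB _ _ _; exists f => t x tT xA.
by rewrite homeoVK // inE; apply: actB => //; apply: homeo_fun.
Qed.

End Transport.

(** * Spheres and boundaries of polydiscs *)

Lemma circle_disc (R : realType) : @circle R `<=` @disc R.
Proof. by move=> z z1; rewrite /disc /= z1. Qed.

Lemma sphere2_ball2 (R : realType) j : @sphere2 R j `<=` @ball2 R j.
Proof. by move=> z z1; rewrite /ball2 /= z1. Qed.

(** The boundary of the polydisc is the unit sphere of the max-norm, and some entry attains that
    norm. *)
Lemma radial_homeo_sphere2 (R : realType) j (h : radial_homeomorphism R j) z :
  @polydisc R j z -> sphere2 (h z) <-> exists k, circle (z ord0 k).
Proof.
move=> zD; have -> : sphere2 (h z) <-> `|z| = 1.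
  rewrite -(radial_homeo_boundary h) boundary_polydiscE.
  split=> [[y /= y1 hyz]|]; last by exists z.
  (* [h] is injective on the polydisc, so the boundary point sent to [h z] is [z] itself. *)
  suff <- : y = z by [].
  have yD : polydisc y by rewrite polydiscE /= y1.
  by rewrite -[y](@homeoK _ _ _ _ h _ (mem_set yD)) hyz homeoK // inE.
split=> [z1|[k zk]].
  have zn0 : mx_norm z != 0 by rewrite [mx_norm z]z1 oner_neq0.
  have [[i k] /= zk] := mx_norm_neq0 zn0.
  by exists k; rewrite ord1 in zk; rewrite /circle /= -zk.
apply/eqP; rewrite eq_le; apply/andP; split; first by move: zD; rewrite polydiscE.
by rewrite -zk norm_coord.
Qed.

(** * The homeomorphism between the two polyhedral products *)

Section WedgeHomeomorphism.
Variables (R : realType) (m : nat) (K : simplicial_complex 'I_m).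
Variables (J : 'I_m -> nat) (J_gt0 : forall i : 'I_m, (0 < J i)%N).
Variable h : forall i : 'I_m, radial_homeomorphism R (J i).

Let L := simplicial_wedge J_gt0 K.

Definition block_row (z : prod_topology (fun _ : wedge_vertex J => Cplx R)) i :
    'rV[Cplx R]_(J i) :=
  \row_k z (Tagged (fun i => 'I_(J i)) k).

Definition of_blocks (z : prod_topology (fun _ : wedge_vertex J => Cplx R)) :
    prod_topology (fun i : 'I_m => 'rV[Cplx R]_(J i)) :=
  fun i => h i (block_row z i).

Definition to_blocks (w : prod_topology (fun i : 'I_m => 'rV[Cplx R]_(J i))) :
    prod_topology (fun _ : wedge_vertex J => Cplx R) :=
  fun v => homeoV (h (tag v)) (w (tag v)) ord0 (tagged v).

Lemma polydisc_block_row z i : (forall v, disc (z v)) -> polydisc (block_row z i).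
Proof. by move=> zD k; rewrite mxE. Qed.

Lemma block_row_to_blocks w i : block_row (to_blocks w) i = homeoV (h i) (w i).
Proof. by apply/rowP => k; rewrite mxE. Qed.

Lemma to_blocksK w : (forall i, ball2 (w i)) -> of_blocks (to_blocks w) = w.
Proof.
move=> wB; apply: functional_extensionality_dep => i.
by rewrite /of_blocks block_row_to_blocks homeoVK // inE.
Qed.

Lemma of_blocksK z : (forall v, disc (z v)) -> to_blocks (of_blocks z) = z.
Proof.
move=> zD; apply/funext => -[i k]; rewrite /to_blocks /of_blocks /=.
by rewrite homeoK ?mxE // inE; apply: polydisc_block_row.
Qed.

Lemma Z_ball_ball2 w : Z_ball R K J w -> forall i, ball2 (w i).
Proof. by move/polyhedral_productP => /(_ (fun i => @sphere2_ball2 R (J i)))[]. Qed.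

Lemma Z_disc_disc z : Z_disc R L z -> forall v, disc (z v).
Proof. by move/polyhedral_productP => /(_ (fun=> @circle_disc R))[]. Qed.

Lemma to_blocks_disc w : (forall i, ball2 (w i)) -> forall v, disc (to_blocks w v).
Proof. by move=> wB v; apply: (homeoV_fun (h (tag v))). Qed.

Lemma Z_ball_of_blocks z : (forall v, disc (z v)) ->
  Z_ball R K J (of_blocks z) <-> Z_disc R L z.
Proof.
move=> zD.
rewrite /Z_ball /Z_disc !polyhedral_productP; last 2 first.
- by move=> v; apply: circle_disc.
- by move=> i; apply: sphere2_ball2.
rewrite mem_simplicial_wedge.
set s := [set i | _]%SET; set t := [set i | _]%SET.
(* [s] collects the indices whose image under [h i] is off the sphere, [t] those whose block is
   entirely off the circle; the complements are compared. *)
have -> : s = t.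
  apply/setP => i; rewrite !inE -[RHS]negbK negb_forall; congr (~~ _).
  apply/asboolP/existsP.
    move=> /(radial_homeo_sphere2 _ (@polydisc_block_row z i zD))[k].
    by rewrite mxE => zk; exists k; rewrite inE negbK; apply/asboolP.
  case=> k; rewrite inE negbK => /asboolP zk.
  apply/(radial_homeo_sphere2 _ (@polydisc_block_row z i zD)).
  by exists k; rewrite mxE.
split=> -[_ tK]; split=> // i.
by apply: (homeo_fun (h i)); apply: polydisc_block_row.
Qed.

Lemma to_blocks_fun : set_fun (Z_ball R K J) (Z_disc R L) to_blocks.
Proof.
move=> w wZ; have wB := Z_ball_ball2 wZ.
by apply/Z_ball_of_blocks; [apply: to_blocks_disc|rewrite to_blocksK].
Qed.

Lemma of_blocks_fun : set_fun (Z_disc R L) (Z_ball R K J) of_blocks.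
Proof. by move=> z zZ; apply/Z_ball_of_blocks => //; apply: Z_disc_disc. Qed.

Lemma to_blocks_continuous : {within Z_ball R K J, continuous to_blocks}.
Proof.
apply: continuous_prod_topology => -[i k].
(* The inverse of [h i] is known to be continuous only on the ball, so the projection must be seen
   to land there. *)
have proj_fun : set_fun (Z_ball R K J) (@ball2 R (J i)) (proj i).
  by move=> w /Z_ball_ball2.
have proj_cont : {within Z_ball R K J, continuous (proj i)}.
  by apply: continuous_subspaceT; apply: proj_continuous.
have := within_continuous_comp_fun proj_fun proj_cont
  (@homeoV_continuous _ _ _ _ (h i)).
apply: (@within_continuous_comp _ _ _ _ _
  (fun M : 'rV[Cplx R]_(J i) => M ord0 k)) => M _; exact: coord_continuous.
Qed.

Lemma of_blocks_continuous : {within Z_disc R L, continuous of_blocks}.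
Proof.
apply: continuous_prod_topology => i.
have row_fun : set_fun (Z_disc R L) (@polydisc R (J i)) (block_row^~ i).
  by move=> z /Z_disc_disc; apply: polydisc_block_row.
have row_cont : {within Z_disc R L, continuous (block_row^~ i)}.
  apply: continuous_subspaceT; apply: continuous_mx => ? k.
  rewrite [X in continuous X](_ : _ = proj (Tagged (fun i => 'I_(J i)) k)).
    exact: proj_continuous.
  by apply/funext => z; rewrite mxE.
exact: within_continuous_comp_fun row_fun row_cont
  (@homeo_continuous _ _ _ _ (h i)).
Qed.

(** Kept transparent so that [ball_action_conj] can unfold the two underlying maps. *)
Definition wedge_homeomorphism : homeomorphism (Z_ball R K J) (Z_disc R L).
Proof.
apply: (@Homeomorphism _ _ _ _ to_blocks of_blocks to_blocks_fun of_blocks_fun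
  _ _ to_blocks_continuous of_blocks_continuous).
- by move=> w; rewrite inE => /Z_ball_ball2/to_blocksK.
- by move=> z; rewrite inE => /Z_disc_disc/of_blocksK.
Defined.

(** Both sides apply [h i] to the same row, so the equality holds at every point, even outside
    [Z_ball]. *)
Lemma ball_action_conj : ball_action h =
  fun t w => homeoV wedge_homeomorphism (diagonal_action t (wedge_homeomorphism w)).
Proof.
apply/funext => t; apply/funext => w; apply: functional_extensionality_dep => i.
by congr (h i _); apply/rowP => k; rewrite !mxE.
Qed.

(** * The diagonal action on the polyhedral product of discs *)

Lemma Z_disc_diagonal_action t z :
  torus t -> Z_disc R L z -> Z_disc R L (diagonal_action t z).
Proof.
(* Multiplication by unit scalars preserves moduli, and [disc] and [circle] depend only on the
   modulus. *)
have norm_action v : torus t -> `|diagonal_action t z v| = `|z v|.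
  by move=> tT; rewrite normrM tT mul1r.
move=> tT [s sL zs]; exists s => // v; have := zs v.
by rewrite /disc /circle /=; case: ifP => _ /=; rewrite norm_action.
Qed.

Lemma diagonal_action_continuous :
  continuous (fun p : prod_topology (fun _ : 'I_m => Cplx R) *
                      prod_topology (fun _ : wedge_vertex J => Cplx R) =>
                diagonal_action p.1 p.2).
Proof.
apply: continuous_prod_topology => v p.
have t_cvg : p'.1 (tag v) @[p' --> p] --> p.1 (tag v).
  apply: (@cvg_comp _ _ _ fst (proj (tag v)) (nbhs p) (nbhs p.1)).
    exact: (cvg_fst (FG := nbhs_filter p.2)).
  exact: proj_continuous.
have z_cvg : p'.2 v @[p' --> p] --> p.2 v.
  apply: (@cvg_comp _ _ _ snd (proj v) (nbhs p) (nbhs p.2)).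
    exact: (cvg_snd (FF := nbhs_filter p.1)).
  exact: proj_continuous.
exact: (@cvgM (Cplx R) _ (nbhs p) (nbhs_filter p) _ _ _ _ t_cvg z_cvg).
Qed.

Lemma torus_action_diagonal : torus_action (Z_disc R L) diagonal_action.
Proof.
split.
- exact: Z_disc_diagonal_action.
- by move=> z _; apply/funext => v; rewrite /diagonal_action mul1r.
- by move=> t u z _ _ _; apply/funext => v; rewrite /diagonal_action mulrA.
- exact: continuous_subspaceT diagonal_action_continuous.
Qed.

End WedgeHomeomorphism.
End Proof.

Theorem theorem7p5 (R : realType) (m : nat) (K : simplicial_complex 'I_m)
    (J : 'I_m -> nat) (J_gt0 : forall i : 'I_m, (0 < J i)%N)
    (h : forall i : 'I_m, radial_homeomorphism R (J i)) :
  [/\ torus_action (Z_ball R K J) (ball_action h),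
      torus_action (Z_disc R (simplicial_wedge J_gt0 K)) diagonal_action &
      equivariantly_homeomorphic
        (Z_ball R K J) (Z_disc R (simplicial_wedge J_gt0 K))
        (ball_action h) diagonal_action].
Proof.
have diag := torus_action_diagonal R K J_gt0.
(* With the ball action written as a conjugate, its action laws and the equivariance both follow by
   transport. *)
rewrite (ball_action_conj K J_gt0); split.
- exact: torus_action_conj.
- exact: diag.
- exact: equivariantly_homeomorphic_conj.
Qed.
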